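(* Let $m\neq 0$ and $a$ be real numbers. For every integer $n\ge 0$ and every real $x$, the noncentral Tanny-Dowling polynomials $\widetilde{\mathcal F}_{m,a}(n;x)$ satisfy $$\widetilde{\mathcal F}_{m,a}(n;x)=\sum_{k=0}^{n}\binom{n}{k}m^k\,w_k\!\left(\frac{x}{m}\right)(-a)^{n-k},$$ where $w_k$ denotes the $k$-th geometric polynomial.
   Context: Let $\genfrac\{\}{0pt}{}{n}{k}$ denote the Stirling numbers of the second kind. The geometric polynomials are $w_n(x)=\sum_{k=0}^n k!\genfrac\{\}{0pt}{}{n}{k}x^k$; equivalently $\sum_{n\ge0}w_n(x)\frac{z^n}{n!}=\frac{1}{1-x(e^z-1)}$. For real $m\ne0$ and real $a$, the noncentral Whitney numbers of the second kind $\widetilde W_{m,a}(n,k)$ ($0\le k\le n$) are given by $\sum_{n\ge k}\widetilde W_{m,a}(n,k)\frac{z^n}{n!}=\frac{e^{-az}}{k!}\left(\frac{e^{mz}-1}{m}\right)^k$. The noncentral Tanny-Dowling polynomials are $\widetilde{\mathcal F}_{m,a}(n;x)=\sum_{k=0}^n k!\,\widetilde W_{m,a}(n,k)x^k$; equivalently, as formal power series in $z$, $\sum_{n\ge0}\widetilde{\mathcal F}_{m,a}(n;x)\frac{z^n}{n!}=\frac{me^{-az}}{m-x(e^{mz}-1)}$. Convention: $0^0=1$. *)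

(* Defs.v *)
From HB Require Import structures.
From mathcomp Require Import all_boot all_order all_algebra.
From mathcomp Require Import reals.

Set Implicit Arguments.
Unset Strict Implicit.
Unset Printing Implicit Defensive.

Import Order.TTheory GRing.Theory Num.Theory.

Local Open Scope ring_scope.

Definition stirling2 (n k : nat) : nat :=
  #|[set P : {set {set 'I_n}} | partition P [set: 'I_n] & #|P| == k]|.

Definition geometric_poly (R : numFieldType) (n : nat) : {poly R} :=
  \poly_(k < n.+1) (k`! * stirling2 n k)%N%:R.

(* A formal power series in z is the sequence of its coefficients:
   f n is the coefficient of z^n. *)
Definition fps (R : numFieldType) : Type := nat -> R.

Definition fps_one (R : numFieldType) : fps R := fun n => (n == 0%N)%:R.

Definition fps_sub (R : numFieldType) (f g : fps R) : fps R :=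
  fun n => f n - g n.

Definition fps_scale (R : numFieldType) (c : R) (f : fps R) : fps R :=
  fun n => c * f n.

Definition fps_mul (R : numFieldType) (f g : fps R) : fps R :=
  fun n => \sum_(i < n.+1) f i * g (n - i)%N.

Definition fps_pow (R : numFieldType) (f : fps R) (k : nat) : fps R :=
  iter k (fps_mul f) (fps_one R).

(* e^(c z) *)
Definition fps_exp (R : numFieldType) (c : R) : fps R :=
  fun n => c ^+ n / n`!%:R.

(* e^(- a z) / k! * ((e^(m z) - 1) / m)^k, for m != 0 *)
Definition ncwhitney2_series (R : numFieldType) (m a : R) (k : nat) : fps R :=
  fps_mul (fps_scale k`!%:R^-1 (fps_exp (- a)))
          (fps_pow (fps_scale m^-1 (fps_sub (fps_exp m) (fps_one R))) k).

(* n! times the coefficient of z^n, i.e. the coefficient of z^n / n!; the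
   series starts at z^k, see ncwhitney2_small. *)
Definition ncwhitney2 (R : numFieldType) (m a : R) (n k : nat) : R :=
  n`!%:R * ncwhitney2_series m a k n.

Definition nctanny_dowling (R : numFieldType) (m a : R) (n : nat) : {poly R} :=
  \poly_(k < n.+1) (k`!%:R * ncwhitney2 m a n k).

Lemma fps_pow_small (R : numFieldType) (f : fps R) (k n : nat) :
  f 0%N = 0 -> (n < k)%N -> fps_pow f k n = 0.
Proof.
move=> f0; elim: k n => [//|k IHk] n ltnk.
rewrite /fps_pow iterS -/(fps_pow f k) /fps_mul big1 // => i _.
case: (posnP i) => [->|i_gt0]; first by rewrite f0 mul0r.
rewrite IHk ?mulr0 //; move: (ltn_ord i); rewrite ltnS => lein.
by rewrite ltn_subLR // (leq_trans ltnk) // -add1n leq_add2r.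
Qed.

Lemma ncwhitney2_small (R : numFieldType) (m a : R) (n k : nat) :
  (n < k)%N -> ncwhitney2 m a n k = 0.
Proof.
move=> ltnk; rewrite /ncwhitney2 /ncwhitney2_series /fps_mul big1 ?mulr0 // => i _.
rewrite fps_pow_small ?mulr0 //; last exact: leq_ltn_trans (leq_subr _ _) ltnk.
by rewrite /fps_scale /fps_sub /fps_exp /fps_one expr0 fact0 divr1 subrr mulr0.
Qed.

(* Main.v *)
Require Import Defs.
From HB Require Import structures.
From mathcomp Require Import all_boot all_order all_algebra.
From mathcomp Require Import reals ring.

(** The defining series of the noncentral Whitney numbers has the factor
    (e^(m z) - 1)^k, and the whole theorem is the expansion
      (e^(m z) - 1)^k = sum_n k! S(n, k) (m z)^n / n!
    ([fps_pow_expm1]): given it, the product with e^(- a z) is a binomial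
    convolution, and summing the coefficients against x^k turns the inner sum
    over k into a geometric polynomial at x / m.

    Here S(n, k) counts set partitions, so the expansion ties a count to a
    series.  Both sides are determined by their binomial transforms in k
    ([binomial_transform_inj]), and both transforms are k^n, up to the common
    factor m^n / n!.
    - On the combinatorial side, k^n counts the maps from an n-set to a k-set.
      Sorting them by the partition into fibres, a partition with j blocks is
      hit by the injections from its blocks to the k-set, k (k - 1) ...
      (k - j + 1) = 'C(k, j) j! in number ([card_preim_partition],
      [expn_stirling2]).
    - On the analytic side, e^(k m z) = (1 + (e^(m z) - 1))^k is expanded by
      the binomial formula ([exp_transform_expm1]).  Power series are handled
      there through their truncations, which are polynomials and so live in a
      commutative ring. *)

Import Order.TTheory GRing.Theory Num.Theory.

Local Open Scope ring_scope.

(** * Counting maps by their partition into fibres *)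

(** A map whose fibres are the blocks of P is the same thing as an injection
    defined on those blocks, composed with the projection that sends a point
    to its block. *)
Lemma card_preim_partition {T U : finType} (P : {set {set T}}) :
  partition P [set: T] ->
  #|[set f : {ffun T -> U} | preim_partition f [set: T] == P]|
  = (#|U| ^_ #|P|)%N.
Proof.
move=> partP; have /and3P[/eqP covP tiP P0] := partP.
have covx x : x \in cover P by rewrite covP inE.
pose D := {B : {set T} | B \in P}.
pose b x : D := exist _ (pblock P x) (pblock_mem (covx x)).
have b_eq x y : (b x == b y) = (y \in pblock P x).
  by rewrite -val_eqE /= eq_pblock.
have b_surj (B : D) : exists x, b x = B.
  case: B => B BP.
  have /set0Pn[x xB] : B != set0 by apply: contraNneq P0 => <-.
  by exists x; apply: val_inj; rewrite /= (def_pblock tiP BP xB).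
pose lift (h : {ffun D -> U}) : {ffun T -> U} := [ffun x => h (b x)].
have lift_inj : injective lift.
  move=> h1 h2 eqh; apply/ffunP => B; have [x <-] := b_surj B.
  by move/ffunP: eqh => /(_ x); rewrite !ffunE.
have cardD : #|{: D}| = #|P| by rewrite card_sig; apply: eq_card.
rewrite -cardD -card_inj_ffuns -(card_imset _ lift_inj); apply: eq_card => f.
rewrite inE; apply/eqP/imsetP => [fP | [h]].
  have f_eq x y : (f x == f y) = (b x == b y).
    rewrite b_eq -fP pblock_equivalence_partition ?inE //.
    by split=> [//|/eqP->].
  have bK (B : D) : {x | b x == B}.
    by apply/sigW; have [x <-] := b_surj B; exists x.
  exists [ffun B => f (sval (bK B))].
    rewrite inE; apply/injectiveP => B1 B2; rewrite !ffunE => /eqP.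
    by rewrite f_eq (eqP (svalP (bK B1))) (eqP (svalP (bK B2))) => /eqP.
  by apply/ffunP => x; rewrite !ffunE; apply/eqP; rewrite f_eq eq_sym (svalP (bK _)).
rewrite inE => /injectiveP h_inj ->.
rewrite -[RHS](equivalence_partition_pblock partP).
rewrite /preim_partition /equivalence_partition.
apply: eq_imset => x; apply/setP => y.
by rewrite !inE !ffunE (inj_eq h_inj) b_eq.
Qed.

Lemma card_ffun_partition (T U : finType) :
  (#|U| ^ #|T| = \sum_(P : {set {set T}} | partition P [set: T]) #|U| ^_ #|P|)%N.
Proof.
rewrite -card_ffun -sum1_card.
rewrite (partition_big (fun f : {ffun T -> U} => preim_partition f [set: T])
           (fun P => partition P [set: T])) /=; last first.
  by move=> f _; apply: preim_partitionP.
apply: eq_bigr => P partP; rewrite -(card_preim_partition P partP) -sum1_card.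
by apply: eq_bigl => f; rewrite !inE.
Qed.

(** Blocks are nonempty, so a transversal has as many points as there are
    blocks. *)
Lemma stirling2_small n k : (n < k)%N -> stirling2 n k = 0%N.
Proof.
move=> ltnk; apply/eqP; rewrite cards_eq0; apply/eqP/setP => P; rewrite !inE.
apply/negbTE; apply: contraL ltnk => /andP[partP /eqP<-].
rewrite -(card_transversal (transversalP partP)) -leqNgt.
by rewrite -[leqRHS]card_ord max_card.
Qed.

Lemma expn_stirling2 n k :
  (k ^ n = \sum_(j < k.+1) j`! * stirling2 n j * 'C(k, j))%N.
Proof.
rewrite -{1}(card_ord k) -{1}(card_ord n) card_ffun_partition card_ord.
(* Partitions with more than k blocks contribute k ^_ #|P| = 0. *)
rewrite (bigID (fun P : {set {set 'I_n}} => (#|P| <= k)%N)) /=.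
rewrite [X in (_ + X)%N]big1 ?addn0; last first.
  by move=> P /andP[_]; rewrite -ltnNge => /ffact_small.
rewrite (partition_big (fun P : {set {set 'I_n}} => inord #|P| : 'I_k.+1)
           predT) //=.
apply: eq_bigr => j _; rewrite mulnAC [(j`! * _)%N]mulnC bin_ffact mulnC.
rewrite -sum_nat_const /=; apply: eq_big => P.
  rewrite inE -andbA; congr andb; apply/andP/eqP => [[leP /eqP<-]|->].
    by rewrite inordK.
  by rewrite -ltnS ltn_ord inord_val eqxx.
by case/andP=> /andP[_ leP] /eqP<-; rewrite inordK.
Qed.

(** * Uniqueness of the binomial transform *)

(** The transform is triangular with 'C(k, k) = 1 on the diagonal. *)
Lemma binomial_transform_inj {V : zmodType} (u v : nat -> V) :
  (forall k, \sum_(j < k.+1) u j *+ 'C(k, j) = \sum_(j < k.+1) v j *+ 'C(k, j)) ->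
  u =1 v.
Proof.
move=> eq_uv k; elim/ltn_ind: k => k IHk; move: (eq_uv k).
rewrite !big_ord_recr /= binn (eq_bigr (fun j : 'I_k => v j *+ 'C(k, j))).
  by move=> /addrI.
by move=> j _; rewrite IHk.
Qed.

(** * Powers of exponential series *)

Definition fps_trunc {R : numFieldType} (N : nat) (f : fps R) : {poly R} :=
  \poly_(i < N.+1) f i.

Lemma coef_fps_trunc {R : numFieldType} {N n : nat} (f : fps R) :
  (n <= N)%N -> (fps_trunc N f)`_n = f n.
Proof. by move=> lenN; rewrite coef_poly ltnS lenN. Qed.

(** The coefficient of z^n in a product depends only on coefficients of
    degree at most n, so truncation beyond n does not affect it. *)
Lemma fps_pow_trunc {R : numFieldType} {N n : nat} (f : fps R) (k : nat) :
  (n <= N)%N -> fps_pow f k n = (fps_trunc N f ^+ k)`_n.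
Proof.
elim: k n => [|k IHk] n lenN; first by rewrite expr0 coef1.
rewrite exprS coefM /fps_pow iterS /fps_mul; apply: eq_bigr => i _.
rewrite -/(fps_pow f k) IHk ?(leq_trans (leq_subr _ _)) // coef_fps_trunc //.
by rewrite (leq_trans _ lenN) // -ltnS.
Qed.

Lemma mulVr_fact_binomial {R : numFieldType} {n i : nat} : (i <= n)%N ->
  i`!%:R^-1 * (n - i)`!%:R^-1 = 'C(n, i)%:R / n`!%:R :> R.
Proof.
move=> lein; have nz j : j`!%:R != 0 :> R by rewrite pnatr_eq0 -lt0n fact_gt0.
apply: (mulIf (nz n)); rewrite divfK // -{1}(bin_fact lein) !natrM -invfM.
by rewrite mulrC -mulrA divff ?mulr1 // mulf_neq0.
Qed.

Lemma fps_mul_exp {R : numFieldType} (c d : R) (n : nat) :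
  fps_mul (fps_exp c) (fps_exp d) n = fps_exp (c + d) n.
Proof.
rewrite /fps_mul /fps_exp addrC exprDn mulr_suml; apply: eq_bigr => i _.
have lein : (i <= n)%N by rewrite -ltnS.
rewrite -[_ *+ 'C(n, i)]mulr_natr -[RHS]mulrA -(mulVr_fact_binomial lein).
by rewrite mulrACA [d ^+ _ * c ^+ _]mulrC.
Qed.

Lemma fps_pow_exp {R : numFieldType} (c : R) (k n : nat) :
  fps_pow (fps_exp c) k n = fps_exp (c *+ k) n.
Proof.
elim: k n => [|k IHk] n.
  by rewrite /fps_exp expr0n; case: n => [|n]; rewrite ?divr1 // mul0r.
rewrite mulrS -fps_mul_exp; apply: eq_bigr => i _.
by rewrite -IHk.
Qed.

(** The binomial formula for (1 + (e^(c z) - 1))^k = e^(c k z), applied to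
    polynomials that agree with the series up to degree n. *)
Lemma exp_transform_expm1 {R : numFieldType} (c : R) (k n : nat) :
  fps_exp (c *+ k) n =
  \sum_(j < k.+1) fps_pow (fps_sub (fps_exp c) (fps_one R)) j n *+ 'C(k, j).
Proof.
rewrite -fps_pow_exp (fps_pow_trunc _ _ (leqnn n)).
have -> : fps_trunc n (fps_exp c)
        = 1 + fps_trunc n (fps_sub (fps_exp c) (fps_one R)).
  apply/polyP => i; rewrite coefD coef1 !coef_poly.
  case: ltnP => [_|lt_ni]; first by rewrite /fps_sub addrC subrK.
  by rewrite addr0 gtn_eqF // (leq_ltn_trans _ lt_ni).
rewrite exprDn coef_sum; apply: eq_bigr => j _.
by rewrite expr1n mul1r coefMn (fps_pow_trunc _ _ (leqnn n)).
Qed.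

Lemma fps_pow_scale {R : numFieldType} (c : R) (f : fps R) (k n : nat) :
  fps_pow (fps_scale c f) k n = c ^+ k * fps_pow f k n.
Proof.
rewrite !(fps_pow_trunc _ _ (leqnn n)) -coefZ -exprZn; congr ((_ ^+ _ : {poly R})`_n).
by apply/polyP => i; rewrite coefZ !coef_poly; case: ifP => //; rewrite mulr0.
Qed.

(** As functions of k, both sides have the binomial transform
    (c k)^n / n!. *)
Lemma fps_pow_expm1 {R : numFieldType} (c : R) (k n : nat) :
  fps_pow (fps_sub (fps_exp c) (fps_one R)) k n
  = c ^+ n / n`!%:R * (k`! * stirling2 n k)%N%:R.
Proof.
apply: (binomial_transform_inj
  (fun j => fps_pow (fps_sub (fps_exp c) (fps_one R)) j n)
  (fun j => c ^+ n / n`!%:R * (j`! * stirling2 n j)%N%:R)) => {}k.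
rewrite -exp_transform_expm1 /fps_exp -[c *+ k]mulr_natr exprMn -natrX expn_stirling2.
rewrite natr_sum mulrAC mulr_sumr; apply: eq_bigr => j _.
by rewrite natrM mulrA mulr_natr.
Qed.

(** * Noncentral Whitney numbers and Tanny-Dowling polynomials *)

(** The factor m^-k of the series is kept next to S(i, k), so that multiplying
    by x^k and summing over k turns it into a value at x / m. *)
Lemma fact_ncwhitney2 {R : numFieldType} (m a : R) (n k : nat) :
  k`!%:R * ncwhitney2 m a n k =
  \sum_(i < n.+1) 'C(n, i)%:R * m ^+ i * (- a) ^+ (n - i)
                  * ((k`! * stirling2 i k)%N%:R / m ^+ k).
Proof.
have nz j : j`!%:R != 0 :> R by rewrite pnatr_eq0 -lt0n fact_gt0.
rewrite /ncwhitney2 /ncwhitney2_series /fps_mul !mulr_sumr.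
(* In the product of series, i is the degree taken from e^(- a z); it is n - i
   in the statement. *)
rewrite (reindex_inj rev_ord_inj) /=; apply: eq_bigr => i _.
have lein : (i <= n)%N by rewrite -ltnS.
rewrite subSS subKn // fps_pow_scale fps_pow_expm1 /fps_scale /fps_exp exprVn.
have -> : 'C(n, i)%:R = n`!%:R * (i`!%:R^-1 * (n - i)`!%:R^-1) :> R.
  by rewrite (mulVr_fact_binomial lein) mulrC divfK.
set s := (_ * stirling2 i k)%N%:R.
rewrite -[RHS](mulfK (nz k)); ring.
Qed.

Theorem theorem1 (R : realType) (m a : R) (hm : m != 0) (n : nat) (x : R) :
  (nctanny_dowling m a n).[x] =
  \sum_(k < n.+1)
    'C(n, k)%:R * m ^+ k * (geometric_poly R k).[x / m] * (- a) ^+ (n - k)%N.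
Proof.
rewrite /nctanny_dowling /geometric_poly horner_poly.
under eq_bigr do rewrite fact_ncwhitney2 mulr_suml.
rewrite exchange_big; apply: eq_bigr => i _ /=.
rewrite horner_poly [RHS]mulrAC mulr_sumr.
(* S(i, k) vanishes for i < k <= n, so both sums over k agree. *)
rewrite (big_ord_widen n.+1
  (fun k => _ * ((k`! * stirling2 i k)%N%:R * (x / m) ^+ k))) //.
rewrite [RHS]big_mkcond; apply: eq_bigr => k _ /=.
case: ltnP => [_|lt_ik].
  by rewrite -!mulrA; do 4!congr (_ * _); rewrite expr_div_n mulrC.
by rewrite stirling2_small // muln0 mul0r mulr0 mul0r.
Qed.
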